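(* Let $G$ be an infinite transitive graph. For $q\in[0,1]$ let $p_c(q)$ denote the critical parameter of Bernoulli bond percolation on the random $2$-lift $G_q$ of $G$. Then the function $q\mapsto p_c(q)$ is continuous on $(0,1)$.
   Context: All base graphs are non-empty, simple, undirected, connected and locally finite. A graph is transitive if its automorphism group acts transitively on its vertices. Random $2$-lift: let $G=(V,E)$, $q\in[0,1]$, and $V^\star=V\times\{0,1\}$; write $v_0,v_1$ for the two lifts of $v\in V$. Let $(\eta_e)_{e\in E}$ be i.i.d. Bernoulli variables with parameter $q$. For each $e=\{u,v\}\in E$ put in $E(\eta)$ the two edges $\{u_0,v_{\eta_e}\}$ and $\{u_1,v_{1-\eta_e}\}$. The random graph $G_q=(V^\star,E(\eta))$ is the random $2$-lift of $G$. Percolation: conditionally on $\eta$, each edge of $G_q$ is open with probability $p$ and closed otherwise, independently; $G_{p,q}$ is the random graph of open edges. Let $\Psi(p,q)$ be the probability (over both $\eta$ and the percolation) that $G_{p,q}$ has an infinite connected component. Then $\Psi(p,q)\in\{0,1\}$ and $\Psi$ is non-decreasing in $p$; the critical parameter is $p_c(q)=\sup\{p\in[0,1]:\Psi(p,q)=0\}$. *)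

(* Defs.v *)
From HB Require Import structures.
From Stdlib Require Import Relation_Operators Operators_Properties.
From mathcomp Require Import all_boot all_order all_algebra.
From mathcomp Require Import ring.
From mathcomp Require Import all_classical all_reals all_analysis.

Set Implicit Arguments.
Unset Strict Implicit.
Unset Printing Implicit Defensive.
Import Order.TTheory GRing.Theory Num.Theory.
Import numFieldNormedType.Exports.
Local Open Scope classical_set_scope.
Local Open Scope ring_scope.

(* Configurations x : I -> bool with the product sigma-algebra; being a
   g_sigma_algebraType, its measurable sets are <<s coordinate_sets I >>. *)
Definition coordinate_sets (I : Type) : set (set (I -> bool)) :=
  [set A | exists i, A = [set x : I -> bool | x i]].

Definition config (I : Type) := g_sigma_algebraType (@coordinate_sets I).

(* Under P the coordinates are independent with P(x i = true) = p. *)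
Definition iid_bernoulli (R : realType) (I : choiceType) (p : R)
    (P : probability (config I) R) : Prop :=
  forall (J : seq I) (b : I -> bool), uniq J ->
    P [set x : config I | forall i, i \in J -> x i = b i] =
    (\prod_(i <- J) bernoulli_pmf p (b i))%:E.

(* The default value is never used for countable I and 0 <= p <= 1: there
   iid_bernoulli p is inhabited and determines P on measurable sets
   (bernoulli_field_iid, iid_bernoulli_unique). *)
Definition bernoulli_field (R : realType) (I : choiceType) (p : R) :
    probability (config I) R :=
  xget (\d_(cst false : config I) : probability (config I) R)
    [set P | iid_bernoulli p P].

Arguments bernoulli_field {R} I p.

(* Existence: cut [l, r[ at l + p * (r - l), record whether x is on the left,
   and recurse in the part containing x.  Under Lebesgue measure on [0, 1[ the
   recorded bits are independent Bernoulli(p). *)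
Fixpoint digit (R : realType) (p : R) (n : nat) (l r x : R) : bool :=
  let m := l + p * (r - l) in
  if n is n'.+1 then if x < m then digit p n' l m x else digit p n' m r x
  else x < m.

Lemma measurable_digit (R : realType) (p : R) n l r :
  measurable ([set x | digit p n l r x] : set (measurableTypeR R)).
Proof.
elim: n l r => [|n IHn] l r /=.
  by rewrite (_ : [set x | _] = `]-oo, l + p * (r - l)[%classic).
set m := l + _.
have mI : measurable (`]-oo, m[%classic : set (measurableTypeR R)) by [].
rewrite (_ : [set x | _] = (`]-oo, m[ `&` [set x | digit p n l m x]) `|`
    (~` `]-oo, m[ `&` [set x | digit p n m r x])).
  apply: measurableU; apply: measurableI => //; exact: measurableC.
apply/seteqP; split => x /=; rewrite in_itv /=.
  by case: ifP => xm h; [left|right].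
by case: ifP => xm [[]|[]].
Qed.

Lemma measurable_pred_digit (R : realType) (p : R) n l r (c : pred bool) :
  measurable ([set x | c (digit p n l r x)] : set (measurableTypeR R)).
Proof.
have mD := measurable_digit p n l r.
rewrite (_ : [set x | _] =
   (if c true then [set x | digit p n l r x] else set0) `|`
   (if c false then ~` [set x | digit p n l r x] else set0)).
  by apply: measurableU; case: ifP => // _; exact: measurableC.
apply/seteqP; split => x /=.
  by case: (boolP (digit p n l r x)) => h cx;
     [left; rewrite cx|right; rewrite cx /=; exact/negP].
by move=> [|]; case: ifP => //= cx; [move=> ->|move/negP/negbTE => ->].
Qed.

Definition digits_in (R : realType) (p : R) n (c : nat -> pred bool) l r :
    set (measurableTypeR R) :=
  [set x | l <= x < r /\ forall i, (i < n)%N -> c i (digit p i l r x)].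

Lemma measurable_digits_in (R : realType) (p : R) n c l r :
  measurable (digits_in p n c l r).
Proof.
elim: n => [|n IHn].
  rewrite (_ : digits_in _ _ _ _ _ = `[l, r[%classic) //.
  by apply/seteqP; split => x /=; rewrite /digits_in /= in_itv; [case|].
rewrite (_ : digits_in _ _ _ _ _ =
  digits_in p n c l r `&` [set x | c n (digit p n l r x)]).
  by apply: measurableI => //; exact: measurable_pred_digit.
apply/seteqP; split => x /=; rewrite /digits_in /=.
  by move=> [-> h]; split; [split => // i /ltnW/h|exact: h].
by move=> [[-> h] hn]; split => // i; rewrite ltnS leq_eqVlt => /predU1P[->|/h].
Qed.

Lemma lebesgue_digits_in (R : realType) (p : R) n c l r :
  0 <= p <= 1 -> l <= r ->
  lebesgue_measure (digits_in p n c l r) =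
  ((r - l) * \prod_(i < n)
    ((c i true)%:R * p + (c i false)%:R * (1 - p)))%:E.
Proof.
move=> /andP[p0 p1]; elim: n c l r => [|n IHn] c l r lr.
  rewrite (_ : digits_in _ _ _ _ _ = `[l, r[%classic); last first.
    by apply/seteqP; split => x /=; rewrite /digits_in /= in_itv; [case|].
  rewrite lebesgue_measure_itv /= lte_fin big_ord0 mulr1.
  case: ifP => [_|/negbT]; first by rewrite EFinB.
  by rewrite -leNgt => rl; rewrite (@le_anti _ _ l r) ?lr// subrr.
set m := l + p * (r - l).
have rl0 : 0 <= r - l by rewrite subr_ge0.
have lm : l <= m by rewrite lerDl mulr_ge0.
have mr : m <= r by rewrite -lerBrDl ler_piMl.
pose c' i := c i.+1.
pose A := if c 0%N true then digits_in p n c' l m else set0.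
pose B := if c 0%N false then digits_in p n c' m r else set0.
have AE x : A x <-> c 0%N true /\ digits_in p n c' l m x.
  by rewrite /A; case: ifP => // _; split => // -[].
have BE x : B x <-> c 0%N false /\ digits_in p n c' m r x.
  by rewrite /B; case: ifP => // _; split => // -[].
have E : digits_in p n.+1 c l r = A `|` B.
  apply/seteqP; split => x.
    move=> [/andP[lx xr] h]; have := h 0%N isT; rewrite /= -/m => h0.
    have hS i : (i < n)%N -> c' i
        (if x < m then digit p i l m x else digit p i m r x).
      by move=> /= ni; exact: (h i.+1).
    move: h0 hS; case: ltP => xm h0 hS; [left; apply/AE|right; apply/BE].
      by split => //; split => //; rewrite lx.
    by split => //; split => //; rewrite xm.
  move=> [/AE|/BE] [c0 [/andP[lx xr] h]]; split.
  - by rewrite lx (lt_le_trans xr).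
  - by move=> [_|i ni] /=; rewrite -/m xr //; exact: h.
  - by rewrite (le_trans lm lx).
  - by move=> [_|i ni] /=; rewrite -/m (ltNge x m) lx //; exact: h.
have mA : measurable A.
  by rewrite /A; case: ifP => // _; exact: measurable_digits_in.
have mB : measurable B.
  by rewrite /B; case: ifP => // _; exact: measurable_digits_in.
rewrite E measureU //; last first.
  apply/seteqP; split => // x [/AE [_ [/andP[_ xm] _]]].
  by move=> /BE [_ [/andP[mx _] _]]; move: xm; rewrite ltNge mx.
rewrite big_ord_recl /=.
set w := \prod_(i < n) _.
have -> : lebesgue_measure A = ((c 0%N true)%:R * (p * (r - l)) * w)%:E.
  rewrite /A; case: ifP => _; last by rewrite measure0 !mul0r.
  by rewrite IHn // /m addrAC subrr add0r (_ : true%:R = 1) // mul1r.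
have -> : lebesgue_measure B = ((c 0%N false)%:R * ((1 - p) * (r - l)) * w)%:E.
  rewrite /B; case: ifP => _; last by rewrite measure0 !mul0r.
  rewrite IHn // (_ : true%:R = 1) // mul1r.
  by rewrite (_ : r - m = (1 - p) * (r - l)) // mulrBl mul1r opprD addrA.
rewrite -EFinD; congr EFin.
by ring.
Qed.

Lemma iid_bernoulli_exists (R : realType) (I : choiceType) (p : R) :
  countable [set: I] -> 0 <= p <= 1 ->
  exists P : probability (config I) R, iid_bernoulli p P.
Proof.
move=> /countable_injP[f fI'] p01.
have fI : injective f by move=> i j; apply: fI'; rewrite in_setT.
pose D : set (measurableTypeR R) := `[0, 1[%classic.
have mD : measurable D by exact: measurable_itv.
pose mu : {measure set (measurableTypeR R) -> \bar R} :=
  mrestr (@lebesgue_measure R) mD.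
have mu1 : mu setT = 1%E.
  rewrite /mu /= /mrestr setTI.
  by rewrite lebesgue_measure_itv /= lte_fin ltr01 -EFinB subr0.
pose U : probability (measurableTypeR R) R :=
  HB.pack (mrestr (@lebesgue_measure R) mD)
    (Measure_isProbability.Build _ _ _ (mrestr (@lebesgue_measure R) mD) mu1).
pose X (x : measurableTypeR R) : config I := fun i => digit p (f i) 0 1 x.
have mX : measurable_fun setT X.
  apply: (@measurability _ _ _ (config I) setT X (@coordinate_sets I) erefl).
  move=> _ [_ [i ->] <-]; rewrite setTI.
  exact: measurable_digit.
pose Xm : {mfun measurableTypeR R >-> config I} :=
  HB.pack X (isMeasurableFun.Build _ _ _ _ X mX).
exists (distribution U Xm) => J b uJ.
pose N := (\max_(i <- J) f i).+1.
have fN i : i \in J -> (f i < N)%N.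
  by move=> iJ; rewrite ltnS; exact: (@leq_bigmax_seq _ J xpredT f).
pose c n : pred bool := fun y => all (fun i => (f i == n) ==> (y == b i)) J.
transitivity (lebesgue_measure (digits_in p N c 0 1)).
  rewrite /distribution /pushforward /= /mrestr; congr lebesgue_measure.
  apply/seteqP; split => x /=; rewrite /digits_in /D /= in_itv /=.
    move=> [h ->]; split => // n nN; apply/allP => i iJ.
    by apply/implyP => /eqP <-; apply/eqP; exact: h.
  move=> [-> h]; split => // i iJ.
  by have /allP/(_ i iJ) := h _ (fN _ iJ); rewrite eqxx => /eqP.
rewrite lebesgue_digits_in // subr0 mul1r; congr EFin.
pose w n : R := (c n true)%:R * p + (c n false)%:R * (1 - p).
rewrite -(big_mkord xpredT w) (bigID (fun n => n \in map f J)) /=.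
rewrite [X in _ * X]big1 ?mulr1; last first.
  move=> n nJ; rewrite /w /c.
  have cn y : all (fun i => (f i == n) ==> (y == b i)) J.
    apply/allP => i iJ; apply/implyP => /eqP fin.
    by move/negP : nJ; case; rewrite -fin map_f.
  by rewrite !cn !mul1r addrC subrK.
rewrite -big_filter.
rewrite (perm_big (map f J)); last first.
  apply: uniq_perm; rewrite ?filter_uniq ?iota_uniq ?map_inj_uniq //.
  move=> n; rewrite mem_filter mem_index_iota /=.
  by case: (boolP (n \in _)) => // /mapP[i iJ ->]; rewrite fN.
rewrite big_map; apply: eq_big_seq => i iJ.
have cE y : c (f i) y = (y == b i).
  apply/allP/idP => [/(_ i iJ)|/eqP -> j jJ]; first by rewrite eqxx.
  by apply/implyP => /eqP /fI ->.
rewrite /w !cE /bernoulli_pmf; case: (b i) => /=.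
  by rewrite mul1r mul0r addr0.
by rewrite mul1r mul0r add0r.
Qed.

Lemma bernoulli_field_iid (R : realType) (I : choiceType) (p : R) :
  countable [set: I] -> 0 <= p <= 1 -> iid_bernoulli p (bernoulli_field I p).
Proof.
by move=> cI p01; rewrite /bernoulli_field; case: xgetP => [P _ //|];
   have [P iP] := iid_bernoulli_exists cI p01 => /(_ P).
Qed.

Lemma iid_bernoulli_unique (R : realType) (I : choiceType) (p : R)
    (P Q : probability (config I) R) :
  iid_bernoulli p P -> iid_bernoulli p Q ->
  forall A : set (config I), measurable A -> P A = Q A.
Proof.
move=> iP iQ.
pose C : set (set (config I)) := [set A | exists J : seq I,
  uniq J /\ A = [set x : config I | forall i, i \in J -> x i = true]].
have mC1 i : measurable [set x : config I | x i = true].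
  by apply: sub_sigma_algebra; exists i.
have CT : C setT by exists [::]; split => //; apply/seteqP; split.
have mC : C `<=` measurable.
  move=> _ [J [_ ->]].
  rewrite (_ : [set x | _] = \bigcap_(i in [set` J]) [set x : config I | x i = true]).
    by rewrite bigcap_seq; apply: bigsetI_measurable => i _; exact: mC1.
  by apply/seteqP; split.
have CI : setI_closed C.
  move=> _ _ [J [_ ->]] [K [_ ->]].
  exists (undup (J ++ K)); split; first exact: undup_uniq.
  apply/seteqP; split => x /=.
    by move=> [hJ hK] i; rewrite mem_undup mem_cat => /orP[/hJ|/hK].
  by move=> h; split => i iJ; apply: h; rewrite mem_undup mem_cat iJ ?orbT.
have sC : measurable = <<s C >> :> set (set (config I)).
  apply/seteqP; split; last first.
    by apply: smallest_sub => //; exact: sigma_algebra_measurable.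
  apply: smallest_sub; first exact: smallest_sigma_algebra.
  move=> _ [i ->]; apply: sub_sigma_algebra; exists [:: i]; split => //.
  apply/seteqP; split => x /=; first by move=> xi j; rewrite inE => /eqP ->.
  by apply; rewrite inE.
move=> A mA.
apply: (@measure_unique _ R (config I) C (fun=> setT) sC CI) => //.
- by rewrite bigcup_const.
- by move=> _ [J [uJ ->]]; rewrite [LHS](iP J xpredT uJ) [RHS](iQ J xpredT uJ).
- by move=> _; apply: (le_lt_trans (probability_le1 P measurableT)); exact: ltry.
Qed.

Record base_graph := BaseGraph {
  vertex :> Type;
  adj : vertex -> vertex -> Prop;
  adj_sym : forall u v, adj u v -> adj v u;
  adj_irr : forall u, ~ adj u u;
  vertex_inhabited : inhabited vertex;
  adj_connected : forall u v, clos_refl_trans vertex adj u v;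
  adj_locally_finite : forall u, finite_set [set v | adj u v] }.

Definition automorphism (G : base_graph) (phi : G -> G) : Prop :=
  bijective phi /\ forall u v, adj (phi u) (phi v) <-> adj u v.

Definition transitive_graph (G : base_graph) : Prop :=
  forall u v : G, exists phi : G -> G, automorphism phi /\ phi u = v.

Definition edges (G : base_graph) : set (set G) :=
  [set e | exists u v, adj u v /\ e = [set u; v]].
Arguments edges : clear implicits.

(* The pairs {u_i, v_j} with u, v adjacent in the base graph, where (v, false)
   is v_0 and (v, true) is v_1: the possible edges of a 2-lift. *)
Definition lift_pairs (G : base_graph) : set (set (G * bool)%type) :=
  [set f | exists u v i j, adj u v /\ f = [set (u, i); (v, j)]].
Arguments lift_pairs : clear implicits.

(* The condition is invariant under exchanging u and v. *)
Definition lift_edges (G : base_graph) (eta : config (edges G)) :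
    set (set (G * bool)%type) :=
  [set f | exists (e : edges G) (u v : G), \val e = [set u; v] /\
    (f = [set (u, false); (v, eta e)] \/
     f = [set (u, true); (v, ~~ eta e)])].

Lemma lift_edges_sub (G : base_graph) (eta : config (edges G)) :
  lift_edges eta `<=` lift_pairs G.
Proof.
move=> f [e [u [v [euv fE]]]]; have /set_mem [u' [v' [auv e']]] := valP e.
have uv : adj u v.
  have hu : [set u'; v'] u by rewrite -e' euv; left.
  have hv : [set u'; v'] v by rewrite -e' euv; right.
  have hu' : [set u; v] u' by rewrite -euv e'; left.
  have hv' : [set u; v] v' by rewrite -euv e'; right.
  have ne : u' <> v' by move=> E; move: auv; rewrite E; exact: adj_irr.
  case: hu hv hu' hv' => /= -> [] /= -> //.
  - by move=> _ [] /= E; case: ne.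
  - by move=> _ _; exact: adj_sym.
  - by move=> [] /= E; case: ne.
by case: fE => ->; [exists u, v, false, (eta e)|exists u, v, true, (~~ eta e)].
Qed.

(* All possible edges carry independent marks omega, independent of eta; the
   open graph G_{p,q} keeps the edges of the lift whose mark is true.  Given
   eta, the marks on the edges of the lift are i.i.d. *)
Definition open_adj (G : base_graph) (eta : config (edges G))
    (omega : config (lift_pairs G)) (x y : G * bool) : Prop :=
  exists f : lift_pairs G,
    [/\ lift_edges eta (\val f), omega f & \val f = [set x; y]].

Definition has_infinite_component (T : Type) (r : T -> T -> Prop) : Prop :=
  exists x, infinite_set [set y | clos_refl_trans T r x y].

(* As (P \x Q) A is the integral over eta of Q (xsection A eta), Psi averages
   over eta the conditional percolation probability on the lift. *)
Definition Psi (R : realType) (G : base_graph) (p q : R) : \bar R :=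
  (bernoulli_field (edges G) q \x bernoulli_field (lift_pairs G) p)%E
    [set z | has_infinite_component (open_adj z.1 z.2)].

Definition p_c (R : realType) (G : base_graph) (q : R) : R :=
  sup [set p : R | 0 <= p <= 1 /\ Psi G p q = 0%E].

Lemma countable_vertex (G : base_graph) : countable [set: G].
Proof.
case: (vertex_inhabited G) => o.
pose ball := fix ball n : set G := if n is n'.+1 then
  ball n' `|` \bigcup_(u in ball n') [set v | adj u v] else [set o].
have fball n : finite_set (ball n).
  elim: n => [|n IHn] /=; first exact: finite_set1.
  rewrite finite_setU; split => //.
  by apply: bigcup_finite => // u _; exact: adj_locally_finite.
rewrite (_ : [set: G] = \bigcup_n ball n).
  by apply: bigcup_countable => // n _; exact: finite_set_countable.
apply/seteqP; split => // v _.
have /clos_rt_rtn1_iff := adj_connected o v.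
elim=> [|u w uw _ [n _ nu]]; first by exists 0%N.
by exists n.+1 => //=; right; exists u.
Qed.

Lemma countable_edges (G : base_graph) : countable [set: edges G].
Proof.
rewrite (eq_countable (card_setT _)).
apply: (@sub_countable _ _ _
  ((fun uv : G * G => [set uv.1; uv.2]) @` [set: G * G])).
  by apply: subset_card_le => _ [u [v [_ ->]]]; exists (u, v).
apply: (sub_countable (card_image_le _ _)).
by rewrite -setXTT; apply: countableX; exact: countable_vertex.
Qed.

Lemma countable_lift_pairs (G : base_graph) : countable [set: lift_pairs G].
Proof.
rewrite (eq_countable (card_setT _)).
pose V2 := ((G * bool) * (G * bool))%type.
apply: (@sub_countable _ _ _
  ((fun xy : V2 => [set xy.1; xy.2]) @` [set: V2])).
  by apply: subset_card_le => _ [u [v [i [j [_ ->]]]]]; exists ((u, i), (v, j)).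
apply: (sub_countable (card_image_le _ _)).
have cV : countable [set: G * bool].
  rewrite -setXTT; apply: countableX; first exact: countable_vertex.
  exact: countableP.
by rewrite -setXTT; exact: countableX.
Qed.

(* Main.v *)
From Stdlib Require Import Relation_Operators.
Require Import Defs.
From mathcomp Require Import all_boot all_order all_algebra.
From mathcomp Require Import finmap lra ring.
From mathcomp Require Import all_classical all_reals all_analysis.
Import Order.TTheory GRing.Theory Num.Theory.
Import numFieldNormedType.Exports.
Local Open Scope classical_set_scope.
Local Open Scope ring_scope.
Set Implicit Arguments.
Unset Strict Implicit.
Unset Printing Implicit Defensive.

(** Let the state of an edge e of G record eta_e and whether each of the two
lifted edges is open.  States of different edges are independent, and the open
graph is determined by the states.

When both lifted edges are closed, the value of eta_e is invisible.  So order
the states by declaring the closed states below every state, and otherwise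
comparing openness for equal values of eta_e.  Enlarging states adds open edges
and never rewires the edges that were already open, hence the event that a
cluster is large is increasing.  For this order, the law of a state with
parameters (p, q) is stochastically dominated by the one with parameters
(p', q') as soon as p <= p' and, for either value of eta_e, the probability
that eta_e has this value and some lifted edge is open does not decrease, that
is,
  q p (2 - p) <= q' p' (2 - p')  and
  (1 - q) p (2 - p) <= (1 - q') p' (2 - p')
([params_le], [state_weight_dominated]).  As p (2 - p) is strictly increasing
on [0, 1], this holds for all q' near q in ]0, 1[ when p < p' are fixed: a small
increase of p pays for a small change of q, in either direction
([params_le_nearby]).

Domination of one state passes to finitely many independent states, by changing
the law of one edge at a time ([expect_dominated]), hence to increasing events
that depend on finitely many edges, and in the limit to the events that the
cluster of a vertex has at least n elements ([lift_law_increasing]).  Letting n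
tend to infinity, Psi p' q' = 0 implies Psi p q = 0 ([Psi_eq0_params_le]); no
zero-one law is involved, since an event that is a countable union is null
exactly when each piece is.  With [params_le_nearby] this bounds p_c near q from
below by every p < p_c q ([p_c_near_ge]) and from above by every p > p_c q
([p_c_near_le]). *)

(** * Expectations of functions of finitely many independent variables *)

Section FiniteExpectation.
Variables (R : realType) (I : choiceType) (T : finType) (o : T).

Definition update (x : I -> T) (i : I) (a : T) : I -> T :=
  fun j => if j == i then a else x j.

Definition reset_outside (s : seq I) (x : I -> T) : I -> T :=
  fun i => if i \in s then x i else o.

(** Expectation of f when the coordinates in s are independent of law w and all
others equal o, written as iterated sums so that the law of one coordinate can
be changed at a time. *)
Fixpoint expect (w : T -> R) (s : seq I) (f : (I -> T) -> R) : R :=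
  if s is i :: s' then
    \sum_(a : T) w a * expect w s' (fun x => f (update x i a))
  else f (fun=> o).

Variable le : T -> T -> Prop.

Definition increasing (X : Type) (leX : X -> X -> Prop) (f : X -> R) : Prop :=
  forall x y, leX x y -> f x <= f y.

Definition pointwise (x y : I -> T) : Prop := forall i, le (x i) (y i).

Definition stoch_dominated (w w' : T -> R) : Prop := forall g : T -> R,
  increasing le g -> \sum_a w a * g a <= \sum_a w' a * g a.

(** Change the law of the first coordinate while the others already follow w':
averaging an increasing function over the other coordinates leaves an increasing
function of the first one. *)
Lemma expect_dominated (w w' : T -> R) (s : seq I) (f : (I -> T) -> R) :
  (forall a, le a a) -> (forall a, 0 <= w a) -> (forall a, 0 <= w' a) ->
  stoch_dominated w w' -> increasing pointwise f ->
  expect w s f <= expect w' s f.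
Proof.
move=> lexx w0 w'0 ww'.
have mono (v : T -> R) (t : seq I) (g h : (I -> T) -> R) :
    (forall a, 0 <= v a) -> (forall x, g x <= h x) ->
    expect v t g <= expect v t h.
  move=> v0; elim: t g h => [|i t IHt] g h gh //=.
  by apply: ler_sum => a _; apply: ler_wpM2l => //; exact: IHt.
elim: s f => [|i s IHs] f fI //=.
apply: (@le_trans _ _ (\sum_a w a * expect w' s (fun x => f (update x i a)))).
  apply: ler_sum => a _; apply: ler_wpM2l => //; apply: IHs => x y xy.
  by apply: fI => j; rewrite /update; case: ifP.
apply: ww' => a b ab; apply: mono => // x.
by apply: fI => j; rewrite /update; case: ifP.
Qed.

End FiniteExpectation.

Section FiniteEvents.
Variables (R : realType) (I : choiceType) (T : finType) (o : T) (w : T -> R).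
Variables (d : measure_display) (Z : measurableType d).
Variable X : Z -> I -> T.
Hypothesis mX : forall i a, measurable [set z | X z i = a].

Lemma reset_outside_cons (i : I) (s : seq I) (x : I -> T) :
  reset_outside o (i :: s) x = update (reset_outside o s x) i (x i).
Proof.
apply/funext => j; rewrite /reset_outside /update inE.
by have [->|] := eqVneq j i.
Qed.

Lemma measurable_finite_event (s : seq I) (A : set (I -> T)) :
  measurable [set z | A (reset_outside o s (X z))].
Proof.
elim: s A => [|i s IHs] A.
  have r0 z : reset_outside o [::] (X z) = fun=> o by apply/funext.
  have [Ao|nAo] := pselect (A (fun=> o)).
    rewrite (_ : [set z | _] = setT) //.
    by apply/seteqP; split => z //= _; rewrite r0.
  rewrite (_ : [set z | _] = set0) //.
  by apply/seteqP; split => z //=; rewrite r0.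
rewrite (_ : [set z | _] = \bigcup_(a in [set: T])
    ([set z | X z i = a] `&`
     [set z | [set x | A (update x i a)] (reset_outside o s (X z))])).
  apply: fin_bigcup_measurable => [|a _]; first exact: finite_finset.
  by apply: measurableI => //; exact: IHs.
apply/seteqP; split => z /=; rewrite reset_outside_cons.
  by move=> Az; exists (X z i).
by move=> [a _ [/= ->]].
Qed.

Lemma measurable_cylinder (J : seq I) (b : I -> T) :
  measurable [set z | forall i, i \in J -> X z i = b i].
Proof.
rewrite (_ : [set z | _] = \bigcap_(i in [set` J]) [set z | X z i = b i]) //.
by rewrite bigcap_seq; apply: bigsetI_measurable => i _; exact: mX.
Qed.

Variable mu : {measure set Z -> \bar R}.
Hypothesis lawX : forall (J : seq I) (b : I -> T), uniq J ->
  mu [set z | forall i, i \in J -> X z i = b i] = (\prod_(i <- J) w (b i))%:E.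

(** The cylinder on J is what makes the induction on s go through: conditioning
on the value of one more coordinate moves it from s to J. *)
Lemma measure_cylinder_finite_event (s J : seq I) (b : I -> T)
    (A : set (I -> T)) : uniq (s ++ J) ->
  mu [set z | (forall i, i \in J -> X z i = b i) /\
              A (reset_outside o s (X z))] =
  ((\prod_(i <- J) w (b i)) * expect o w s (\1_A))%:E.
Proof.
elim: s J b A => [|e s IHs] J b A.
  move=> uJ /=.
  have r0 z : reset_outside o [::] (X z) = fun=> o by apply/funext.
  rewrite indicE; case: (boolP ((fun=> o) \in A)) => Ao.
    rewrite (_ : [set z | _] = [set z | forall i, i \in J -> X z i = b i]).
      by rewrite lawX // mulr1.
    apply/seteqP; split => z /=; rewrite r0; first by case.
    by split => //; exact/set_mem.
  rewrite (_ : [set z | _] = set0); first by rewrite measure0 mulr0.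
  by apply/seteqP; split => z //=; rewrite r0 => -[_ /mem_set]; exact/negP.
move=> /= /andP[]; rewrite mem_cat negb_or => /andP[es eJ] usJ.
pose S (a : T) := [set z |
  (forall i, i \in e :: J -> X z i = update b e a i) /\
  [set x | A (update x e a)] (reset_outside o s (X z))].
have usJ' : uniq (s ++ e :: J).
  by rewrite uniq_catC cat_cons /= mem_cat negb_or eJ es uniq_catC.
have -> : [set z | (forall i, i \in J -> X z i = b i) /\
    A (reset_outside o (e :: s) (X z))] = \bigcup_(a in [set: T]) S a.
  apply/seteqP; split => z /=; rewrite reset_outside_cons.
    move=> [h Az]; exists (X z e) => //; split => //= i.
    rewrite /update inE; have [->//|ie /= iJ] := eqVneq i e.
    exact: h.
  move=> [a _ [h Az]]; have Xe : X z e = a.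
    by rewrite (h e) ?mem_head // /update eqxx.
  split; last by rewrite Xe.
  move=> i iJ; rewrite (h i) ?inE ?iJ ?orbT // /update.
  by case: eqP => // ie; rewrite -ie iJ in eJ.
rewrite measure_fin_bigcup //; first last.
- move=> a _; apply: measurableI; first exact: measurable_cylinder.
  exact: measurable_finite_event.
- move=> a a' _ _ [z [[h _] [h' _]]].
  by have := h e; have := h' e; rewrite mem_head /update eqxx => <- // <-.
- exact: finite_finset.
have -> : [set: T] = [set` enum T].
  by apply/seteqP; split => a //= _; rewrite /= mem_enum.
rewrite -fsbig_seq ?enum_uniq // big_enum /= mulr_sumr -sumEFin.
apply: eq_bigr => a _.
rewrite [LHS](IHs (e :: J) (update b e a) [set x | A (update x e a)] usJ').
rewrite big_cons /update eqxx.
rewrite -(_ : \prod_(i <- J) w (b i) =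
  \prod_(j <- J) w (if j == e then a else b j)); last first.
  apply: eq_big_seq => i iJ; case: eqP => // ie.
  by rewrite -ie iJ in eJ.
by congr EFin; rewrite mulrAC mulrC mulrA.
Qed.

Lemma measure_finite_event (s : seq I) (A : set (I -> T)) : uniq s ->
  mu [set z | A (reset_outside o s (X z))] = (expect o w s (\1_A))%:E.
Proof.
move=> us.
have := @measure_cylinder_finite_event s [::] (fun=> o) A.
rewrite cats0 big_nil mul1r => /(_ us) <-; congr (mu _); apply/seteqP.
by split => z //= -[].
Qed.

End FiniteEvents.

(** * The state of an edge of the lift *)

(** (eta_e, openness of the lifted edge at the copy false of the source,
openness of the one at the copy true). *)
Definition edge_state := (bool * bool * bool)%type.

Definition closed_state : edge_state := (false, false, false).

(** A closed state is below all others, whatever its lift bit: this makes a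
change of the lift bit of a closed edge free.  The relation is a preorder: the
two closed states are equivalent. *)
Definition state_le (s t : edge_state) : Prop :=
  ~~ s.1.2 && ~~ s.2 \/ [/\ s.1.1 = t.1.1, s.1.2 ==> t.1.2 & s.2 ==> t.2].

Lemma state_le_refl s : state_le s s.
Proof. by right; rewrite !implybb. Qed.

Lemma closed_state_le s : state_le closed_state s.
Proof. by left. Qed.

Definition state_weight (R : realType) (p q : R) (s : edge_state) : R :=
  bernoulli_pmf q s.1.1 * (bernoulli_pmf p s.1.2 * bernoulli_pmf p s.2).

(** The quantity p * (2 - p) = 1 - (1 - p) ^+ 2 is the probability that at least
one of the two lifted edges is open. *)
Definition params_le (R : realType) (p q p' q' : R) : Prop :=
  [/\ p <= p', q * (p * (2 - p)) <= q' * (p' * (2 - p')) &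
      (1 - q) * (p * (2 - p)) <= (1 - q') * (p' * (2 - p'))].

Lemma big_state (R : realType) (F : edge_state -> R) :
  \sum_s F s = \sum_(a : bool) (F (a, true, true) + F (a, true, false) +
                                (F (a, false, true) + F (a, false, false))).
Proof.
transitivity (\sum_(x : bool * bool) \sum_(b : bool) F (x, b)).
  by rewrite pair_bigA; apply: eq_bigr => -[].
transitivity (\sum_(a : bool) \sum_(b : bool) \sum_(c : bool) F (a, b, c)).
  by rewrite [RHS]pair_bigA; apply: eq_bigr => -[].
by apply: eq_bigr => a _; rewrite !big_bool.
Qed.

(** Here Q is the probability of one value of the lift bit, and x, y, z are what
an increasing function gains over closed edges when only the first lifted edge,
only the second, or both are open.  Both sides are linear in (x, y, z), and for
x <= y <= z the vector (x, y, z) is a nonnegative combination of (1, 1, 1),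
(0, 1, 1) and (0, 0, 1).  It remains to compare the coefficients Q p (2 - p),
Q p and Q p^2 of the three; the first comparison is the hypothesis, and implies
the other two because p <= p'. *)
Lemma open_gain_le (R : realType) (p p' Q Q' x y z : R) :
  0 <= p <= 1 -> p <= p' <= 1 -> 0 <= Q -> 0 <= Q' ->
  Q * (p * (2 - p)) <= Q' * (p' * (2 - p')) ->
  0 <= x <= z -> 0 <= y <= z ->
  Q * (p * (1 - p) * (x + y) + p ^+ 2 * z) <=
  Q' * (p' * (1 - p') * (x + y) + p' ^+ 2 * z).
Proof.
move=> /andP[p0 p1] /andP[pp' p'1] Q0 Q'0 H3 /andP[x0 xz] /andP[y0 yz].
have H2 : Q * p <= Q' * p'.
  have h : (Q * p) * (2 - p) <= (Q' * p') * (2 - p).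
    rewrite -mulrA; apply: (le_trans H3); rewrite -mulrA.
    apply: ler_wpM2l => //; apply: ler_wpM2l; lra.
  by rewrite ler_pM2r in h => //; lra.
have H1 : Q * p ^+ 2 <= Q' * p' ^+ 2.
  by rewrite !expr2 !mulrA; apply: ler_pM => //; rewrite mulr_ge0.
wlog xy : x y x0 xz y0 yz / x <= y.
  move=> W; case: (leP x y) => [|/ltW] xy; first exact: W.
  by rewrite [x + y]addrC; exact: W.
have E (r S : R) : S * (r * (1 - r) * (x + y) + r ^+ 2 * z) =
    S * (r * (2 - r)) * x + S * r * (y - x) + S * r ^+ 2 * (z - y) by ring.
by rewrite !E !lerD // ler_wpM2r // subr_ge0.
Qed.

Lemma state_weight_ge0 (R : realType) (p q : R) s :
  0 <= p <= 1 -> 0 <= q <= 1 -> 0 <= state_weight p q s.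
Proof.
move=> /andP[p0 p1] /andP[q0 q1]; rewrite /state_weight /bernoulli_pmf.
by case: s => [[[] []] []] /=; rewrite !mulr_ge0 // subr_ge0.
Qed.

(** An increasing function has a common value t at the two closed states, so its
expectation is t plus the gains over t of the two lift bits. *)
Lemma state_weight_dominated (R : realType) (p q p' q' : R) :
  0 <= p <= 1 -> 0 <= q <= 1 -> 0 <= p' <= 1 -> 0 <= q' <= 1 ->
  params_le p q p' q' ->
  stoch_dominated state_le (state_weight p q) (state_weight p' q').
Proof.
move=> p01 /andP[q0 q1] /andP[p'0 p'1] /andP[q'0 q'1] [pp' H1 H0] g gI.
have g00 : g (true, false, false) = g (false, false, false).
  by apply/le_anti; rewrite !gI //; left.
have g1 (a b c : bool) : g (a, false, false) <= g (a, b, c) by apply: gI; left.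
have g2 (a b c : bool) : g (a, b, c) <= g (a, true, true).
  by apply: gI; right; split=> //=; rewrite implybT.
rewrite !big_state !big_bool /state_weight /bernoulli_pmf /= g00.
set t := g (false, false, false).
pose x a := g (a, true, false) - t; pose y a := g (a, false, true) - t.
pose z a := g (a, true, true) - t.
have tE a : g (a, false, false) = t by case: a.
have gain (a : bool) (Q Q' : R) : 0 <= Q -> 0 <= Q' ->
    Q * (p * (2 - p)) <= Q' * (p' * (2 - p')) ->
    Q * (p * (1 - p) * (x a + y a) + p ^+ 2 * z a) <=
    Q' * (p' * (1 - p') * (x a + y a) + p' ^+ 2 * z a).
  move=> Q0 Q'0 H; apply: open_gain_le => //; first by rewrite pp'.
    by rewrite /x /z lerB // subr_ge0 -(tE a) g1.
  by rewrite /y /z lerB // subr_ge0 -(tE a) g1.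
have G1 := gain true q q' q0 q'0 H1.
have G0 : (1 - q) * (p * (1 - p) * (x false + y false) + p ^+ 2 * z false) <=
    (1 - q') * (p' * (1 - p') * (x false + y false) + p' ^+ 2 * z false).
  by apply: gain => //; rewrite subr_ge0.
rewrite -subr_ge0; move: (lerD G1 G0); rewrite -subr_ge0.
congr (0 <= _); rewrite /x /y /z; ring.
Qed.

Section LiftStates.
Variable G : base_graph.

Lemma edge_endsP (e : edges G) :
  exists uv : G * G, adj uv.1 uv.2 /\ \val e = [set uv.1; uv.2].
Proof. by have /set_mem [u [v [uv ->]]] := valP e; exists (u, v). Qed.

(** An arbitrary orientation of e.  The lift attached to a value of eta_e does
not depend on it. *)
Definition src (e : edges G) : G := (projT1 (cid (edge_endsP e))).1.
Definition dst (e : edges G) : G := (projT1 (cid (edge_endsP e))).2.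

Lemma adj_ends e : adj (src e) (dst e).
Proof. by rewrite /src /dst; case: cid => x []. Qed.

Lemma edge_ends e : \val e = [set src e; dst e].
Proof. by rewrite /src /dst; case: cid => x []. Qed.

Lemma lift_pairP e i j : lift_pairs G [set (src e, i); (dst e, j)].
Proof. by exists (src e), (dst e), i, j; split => //; exact: adj_ends. Qed.

Definition lift_pair e i j : lift_pairs G := SigSub (mem_set (lift_pairP e i j)).

Lemma lift_pair_inj e i j e' i' j' :
  lift_pair e i j = lift_pair e' i' j' -> e = e' /\ i = i'.
Proof.
move=> /(congr1 val) /= E.
have ee' : e = e'.
  apply/val_inj; rewrite /= !edge_ends.
  have := congr1 (fun A => fst @` A) E.
  by rewrite !image_setU !image_set1.
split => //; rewrite -{}ee' in E.
have : [set (src e, i'); (dst e, j')] (src e, i) by rewrite -E; left.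
by case=> [[//]|[sd _]]; have := adj_ends e; rewrite sd => /adj_irr.
Qed.

(** The two marks read are those of the edges present in the lift, which depend
on z.1 e; the marks of the other two pairs above e are ignored. *)
Definition state (z : config (edges G) * config (lift_pairs G))
    (e : edges G) : edge_state :=
  (z.1 e, z.2 (lift_pair e false (z.1 e)), z.2 (lift_pair e true (~~ z.1 e))).

Lemma measurable_coord (I : Type) (i : I) b :
  measurable [set x : config I | x i = b].
Proof.
have mt : measurable [set x : config I | x i].
  by apply: sub_sigma_algebra; exists i.
case: b => //; rewrite (_ : [set x | _] = ~` [set x : config I | x i]).
  exact: measurableC.
by apply/seteqP; split => x /=; [move=> -> | move/negP/negbTE].
Qed.

Lemma measurable_state e s : measurable [set z | state z e = s].
Proof.
case: s => [[a b] c].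
rewrite (_ : [set z | _] = [set x : config (edges G) | x e = a] `*`
  ([set y : config (lift_pairs G) | y (lift_pair e false a) = b] `&`
   [set y : config (lift_pairs G) | y (lift_pair e true (~~ a)) = c])).
  apply: measurableX; first exact: measurable_coord.
  by apply: measurableI; exact: measurable_coord.
apply/seteqP; split => -[x y] /=; rewrite /state /=.
  by case=> -> -> ->.
by case=> -> [-> ->].
Qed.

Definition open_step (x : edges G -> edge_state) (v w : G * bool) : Prop :=
  exists e,
    (x e).1.2 /\ [set v; w] = [set (src e, false); (dst e, (x e).1.1)] \/
    (x e).2 /\ [set v; w] = [set (src e, true); (dst e, ~~ (x e).1.1)].

Lemma set2_eq (T : Type) (a b c d : T) : [set a; b] = [set c; d] ->
  a = c /\ b = d \/ a = d /\ b = c.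
Proof.
move=> E.
have ha : [set c; d] a by rewrite -E; left.
have hb : [set c; d] b by rewrite -E; right.
have hc : [set a; b] c by rewrite E; left.
have hd : [set a; b] d by rewrite E; right.
by case: ha => ha; case: hb => hb; case: hc => hc; case: hd => hd;
   rewrite /= in ha hb hc hd; subst; auto.
Qed.

Lemma open_adjE z v w : open_adj z.1 z.2 v w <-> open_step (state z) v w.
Proof.
split.
  move=> [f [[e [u [t [euv fE]]]] fo fvw]]; rewrite /open_step; exists e.
  rewrite -fvw /state /=.
  have fL i j : \val f = [set (src e, i); (dst e, j)] -> z.2 (lift_pair e i j).
    by move=> h; rewrite (_ : lift_pair e i j = f) //; apply/val_inj.
  suff : \val f = [set (src e, false); (dst e, z.1 e)] \/
         \val f = [set (src e, true); (dst e, ~~ z.1 e)].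
    by case=> h; [left|right]; split => //; exact: fL.
  rewrite edge_ends in euv; case: (set2_eq euv) => -[<- <-] // in fE *.
  by case: fE => ->; case: (z.1 e) => /=; rewrite setUC; auto.
move=> [e [[op vw]|[op vw]]].
  exists (lift_pair e false (z.1 e)); split => //.
  by exists e, (src e), (dst e); rewrite -edge_ends; split => //; left.
exists (lift_pair e true (~~ z.1 e)); split => //.
by exists e, (src e), (dst e); rewrite -edge_ends; split => //; right.
Qed.

End LiftStates.

(** * Increasing events of the percolation on the lift *)

Definition lift_law (R : realType) (G : base_graph) (p q : R) :
    {measure set (config (edges G) * config (lift_pairs G)) -> \bar R} :=
  (bernoulli_field (edges G) q \x bernoulli_field (lift_pairs G) p)%E.

Arguments lift_law {R} G p q.

Section Law.
Variables (R : realType) (G : base_graph).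

(** Given the prescribed values of eta on J, prescribing the states amounts to
prescribing the marks of two pairs above each edge of J.  These pairs are
distinct, so the event is a product of two cylinders. *)
Lemma lift_law_state (p q : R) (J : seq (edges G)) (b : edges G -> edge_state) :
  0 <= p <= 1 -> 0 <= q <= 1 -> uniq J ->
  lift_law G p q [set z | forall e, e \in J -> state z e = b e] =
  (\prod_(e <- J) state_weight p q (b e))%:E.
Proof.
move=> p01 q01 uJ.
pose l0 e := lift_pair e false (b e).1.1.
pose l1 e := lift_pair e true (~~ (b e).1.1).
(* Prescribed marks, as a function on all pairs; it is only used on l0 and l1. *)
pose c f := `[< exists e, f = l0 e /\ (b e).1.2 \/ f = l1 e /\ (b e).2 >].
have c0 e : c (l0 e) = (b e).1.2.
  apply/asboolP/idP => [[e' [[/lift_pair_inj[-> _]]|[/lift_pair_inj[_]]]]|be] //.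
  by exists e; left.
have c1 e : c (l1 e) = (b e).2.
  apply/asboolP/idP => [[e' [[/lift_pair_inj[_ ]]|[/lift_pair_inj[-> _]]]]|be] //.
  by exists e; right.
pose L := map l0 J ++ map l1 J.
have uL : uniq L.
  rewrite cat_uniq !map_inj_uniq ?uJ ?andbT /=; first last.
  - by move=> e e' /lift_pair_inj[].
  - by move=> e e' /lift_pair_inj[].
  - apply/hasPn => _ /mapP[e _ ->]; apply/negP => /mapP[e' _].
    by move=> /lift_pair_inj[].
rewrite (_ : [set z | _] =
   [set x : config (edges G) | forall e, e \in J -> x e = (b e).1.1] `*`
   [set y : config (lift_pairs G) | forall f, f \in L -> y f = c f]); last first.
  apply/seteqP; split => -[x y] /= h.
    have h0 e (eJ : e \in J) : x e = (b e).1.1 by rewrite -(h e eJ).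
    split=> // f; rewrite mem_cat => /orP[] /mapP[e eJ ->].
      by rewrite c0 -(h e eJ) /state /l0 /= -(h0 e eJ).
    by rewrite c1 -(h e eJ) /state /l1 /= -(h0 e eJ).
  case: h => hx hy e eJ; rewrite /state /= hx // [in LHS](hy (l0 e)); last first.
    by rewrite mem_cat map_f.
  rewrite (hy (l1 e)); last by rewrite mem_cat (map_f _ eJ) orbT.
  by rewrite c0 c1; case: (b e) => [[]].
have mcyl (I : choiceType) (K : seq I) (a : I -> bool) :
    measurable [set x : config I | forall i, i \in K -> x i = a i].
  rewrite (_ : [set x | _] =
    \bigcap_(i in [set` K]) [set x : config I | x i = a i]) //.
  by rewrite bigcap_seq; apply: bigsetI_measurable => i _; exact: measurable_coord.
rewrite [LHS]product_measure1E; [|exact: mcyl|exact: mcyl].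
have Hx := bernoulli_field_iid (countable_edges G) q01 (fun e => (b e).1.1) uJ.
have Hy := bernoulli_field_iid (countable_lift_pairs G) p01 c uL.
rewrite [X in (X * _)%E]Hx [X in (_ * X)%E]Hy.
rewrite -EFinM; congr EFin.
rewrite big_cat /= !big_map -!big_split /=.
by apply: eq_bigr => e _; rewrite c0 c1.
Qed.

Lemma edge_exhaustion : exists s : nat -> seq (edges G),
  [/\ forall k, uniq (s k), {homo s : k l / (k <= l)%N >-> {subset k <= l}} &
      forall e, exists k, e \in s k].
Proof.
have /countable_injP[f fI'] := countable_edges G.
have fI : injective f by move=> i j; apply: fI'; rewrite in_setT.
have fin k : finite_set [set e | (f e < k)%N].
  apply: (@finite_preimage _ _ `I_k f); last exact: finite_II.
  by move=> e e' _ _; exact: fI.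
exists (fun k => fset_set [set e | (f e < k)%N]); split.
- by move=> k; exact: fset_uniq.
- move=> k l kl e; rewrite !in_fset_set // => /set_mem /= ek.
  by apply/mem_set => /=; exact: (leq_trans ek).
- by move=> e; exists (f e).+1; rewrite in_fset_set //; apply/mem_set => /=.
Qed.

Variable s : nat -> seq (edges G).
Hypothesis us : forall k, uniq (s k).
Hypothesis s_homo : {homo s : k l / (k <= l)%N >-> {subset k <= l}}.

Let cut k (x : edges G -> edge_state) := reset_outside closed_state (s k) x.

Lemma cut_le k x : pointwise state_le (cut k x) x.
Proof.
move=> e; rewrite /cut /reset_outside; case: ifP => _.
  exact: state_le_refl.
exact: closed_state_le.
Qed.

Lemma cut_homo k l x : (k <= l)%N -> pointwise state_le (cut k x) (cut l x).
Proof.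
move=> kl e; rewrite /cut /reset_outside; case: ifP => [/(s_homo kl) ->|_].
  exact: state_le_refl.
exact: closed_state_le.
Qed.

Variable A : set (edges G -> edge_state).
Hypothesis A_up : forall x y, pointwise state_le x y -> A x -> A y.
Hypothesis A_fin : forall x, A x -> exists k, A (cut k x).

Let AE : [set z | A (state z)] = \bigcup_k [set z | A (cut k (state z))].
Proof.
apply/seteqP; split => z /=.
  by move=> /A_fin[k Ak]; exists k.
by move=> [k _]; apply: A_up; exact: cut_le.
Qed.

Lemma measurable_increasing : measurable [set z | A (state z)].
Proof.
rewrite AE; apply: bigcup_measurable => k _.
by apply: measurable_finite_event; exact: measurable_state.
Qed.

(** A is the increasing union of the events that A still holds once the edges
outside s k are closed; these depend on finitely many edges. *)
Lemma lift_law_increasing (p q p' q' : R) :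
  0 <= p <= 1 -> 0 <= q <= 1 -> 0 <= p' <= 1 -> 0 <= q' <= 1 ->
  params_le p q p' q' ->
  (lift_law G p q [set z | A (state z)] <=
   lift_law G p' q' [set z | A (state z)])%E.
Proof.
move=> p01 q01 p'01 q'01 easy.
have mk k : measurable [set z | A (cut k (state z))].
  by apply: measurable_finite_event; exact: measurable_state.
have mU : measurable (\bigcup_k [set z | A (cut k (state z))]).
  by rewrite -AE; exact: measurable_increasing.
have nd : nondecreasing_seq (fun k => [set z | A (cut k (state z))]).
  by move=> k l kl; apply/subsetPset => z; apply: A_up; exact: cut_homo.
rewrite AE.
have cv (m : {measure set (config (edges G) * config (lift_pairs G)) -> \bar R}) :=
  @nondecreasing_cvg_mu _ _ _ m _ mk mU nd.
apply: (lee_cvg_to (cv (lift_law G p q)) (cv (lift_law G p' q'))).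
apply: nearW => k /=.
rewrite (measure_finite_event closed_state (@measurable_state G)
  (fun J b => @lift_law_state p q J b p01 q01)) //.
rewrite (measure_finite_event closed_state (@measurable_state G)
  (fun J b => @lift_law_state p' q' J b p'01 q'01)) //.
rewrite lee_fin; apply: (@expect_dominated _ _ _ _ state_le).
- exact: state_le_refl.
- by move=> a; exact: state_weight_ge0.
- by move=> a; exact: state_weight_ge0.
- exact: state_weight_dominated.
- move=> x y xy; rewrite !indicE.
  case: (boolP (x \in A)) => // /set_mem Ax.
  by rewrite (mem_set (A_up xy Ax)).
Qed.

End Law.

(** * Clusters and the critical value *)

(** Infinitude as a countable intersection of conditions each of which has a
finite witness. *)
Lemma infinite_set_injP (T : Type) (A : set T) :
  infinite_set A <->
  forall n, exists c : 'I_n -> T, injective c /\ forall i, A (c i).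
Proof.
elim/Pchoice: T => T in A *; rewrite infinite_set_fsetP; split => h n.
  have [B BA nB] := h n; have iB (i : 'I_n) : (i < size B)%N.
    exact: leq_trans nB.
  exists (fun i => tnth (in_tuple B) (Ordinal (iB i))); split.
    by move=> i j /tuple_uniqP - /(_ (fset_uniq B)) [ij]; exact/val_inj.
  by move=> i; apply: BA => /=; exact: mem_tnth.
have [c [cI cA]] := h n.
exists [fset c i | i in 'I_n]%fset.
  by move=> x /= /imfsetP[i _ ->].
by rewrite card_imfset //= size_enum_ord.
Qed.

Section Clusters.
Variable G : base_graph.
Implicit Types (x y : edges G -> edge_state) (v w : G * bool) (n : nat).

Definition reach x := clos_refl_trans (G * bool) (open_step x).

Definition large_cluster v n : set (edges G -> edge_state) :=
  [set x | exists c : 'I_n -> G * bool,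
    injective c /\ forall i, reach x v (c i)].

Lemma infinite_componentE z :
  has_infinite_component (open_adj z.1 z.2) <->
  exists v, forall n, large_cluster v n (@state G z).
Proof.
have E v w : clos_refl_trans (G * bool) (open_adj z.1 z.2) v w <->
    reach (state z) v w.
  split; elim=> [a b /open_adjE ab|a|a b c _ ab _ bc].
  - exact: rt_step.
  - exact: rt_refl.
  - exact: rt_trans ab bc.
  - exact: rt_step.
  - exact: rt_refl.
  - exact: rt_trans ab bc.
split=> -[v H]; exists v.
  move=> n; have [c [cI cR]] := (infinite_set_injP _).1 H n.
  by exists c; split => // i; apply/E; exact: cR.
apply/infinite_set_injP => n; have [c [cI cR]] := H n.
by exists c; split => // i; apply/E; exact: cR.
Qed.

Lemma open_step_le x y v w :
  pointwise state_le x y -> open_step x v w -> open_step y v w.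
Proof.
move=> xy [e H]; exists e.
case: (xy e) => [/andP[/negP nx1 /negP nx2]|[xye /implyP xy1 /implyP xy2]].
  by case: H => -[].
by rewrite -xye; case: H => -[/[dup] xo]; [move/xy1|move/xy2]; auto.
Qed.

Lemma reach_le x y v w : pointwise state_le x y -> reach x v w -> reach y v w.
Proof.
move=> xy; elim=> [a b ab|a|a b c _ ab _ bc].
- by apply: rt_step; exact: open_step_le ab.
- exact: rt_refl.
- exact: rt_trans ab bc.
Qed.

Lemma large_cluster_le v n x y :
  pointwise state_le x y -> large_cluster v n x -> large_cluster v n y.
Proof.
by move=> xy [c [cI cR]]; exists c; split => // i; exact: reach_le (cR i).
Qed.

Variable s : nat -> seq (edges G).
Hypothesis s_homo : {homo s : k l / (k <= l)%N >-> {subset k <= l}}.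
Hypothesis s_cover : forall e, exists k, e \in s k.

(** A path uses finitely many edges. *)
Lemma reach_finite x v w : reach x v w ->
  exists k, reach (reset_outside closed_state (s k) x) v w.
Proof.
elim=> [a b [e ab]|a|a b c _ [k ab] _ [l bc]].
- have [k ek] := s_cover e; exists k; apply: rt_step; exists e.
  by rewrite /reset_outside ek.
- by exists 0%N; exact: rt_refl.
- exists (maxn k l); apply: (@rt_trans _ _ _ b).
    by apply: reach_le ab; apply: cut_homo => //; exact: leq_maxl.
  by apply: reach_le bc; apply: cut_homo => //; exact: leq_maxr.
Qed.

Lemma large_cluster_finite v n x : large_cluster v n x ->
  exists k, large_cluster v n (reset_outside closed_state (s k) x).
Proof.
move=> [c [cI cR]].
have [k kR] := choice (fun i => reach_finite (cR i)).
exists (\max_i k i)%N, c; split => // i.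
by apply: reach_le (kR i); apply: cut_homo => //; exact: leq_bigmax.
Qed.

End Clusters.

(** The event of an infinite cluster is the union over the vertices v of the
decreasing intersections over n of the events L v n that the cluster of v has at
least n elements.  The inequality for each L v n passes to the intersection,
and a countable union of null events is null. *)
Lemma Psi_eq0_params_le (R : realType) (G : base_graph) (p q p' q' : R) :
  0 <= p <= 1 -> 0 <= q <= 1 -> 0 <= p' <= 1 -> 0 <= q' <= 1 ->
  params_le p q p' q' -> Psi G p' q' = 0%E -> Psi G p q = 0%E.
Proof.
move=> p01 q01 p'01 q'01 easy.
have [s [us s_homo s_cover]] := edge_exhaustion G.
pose L v n := [set z | @large_cluster G v n (state z)].
have mL v n : measurable (L v n).
  apply: (measurable_increasing (s := s)).
    by move=> x y; exact: large_cluster_le.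
  by move=> x; exact: large_cluster_finite.
have leL v n : (lift_law G p q (L v n) <= lift_law G p' q' (L v n))%E.
  apply: (lift_law_increasing us s_homo) => //.
    by move=> x y; exact: large_cluster_le.
  by move=> x; exact: large_cluster_finite.
have niL v : nonincreasing_seq (L v).
  move=> m n mn; apply/subsetPset => z [c [cI cR]].
  exists (fun i => c (widen_ord mn i)); split => // i j /cI /(congr1 val) ij.
  exact/val_inj.
have mC v : measurable (\bigcap_n L v n) by exact: bigcap_measurable.
have PsiE (r t : R) :
    Psi G r t = lift_law G r t (\bigcup_v \bigcap_n L v n).
  congr (lift_law G r t _); apply/seteqP; split => z /=.
    by move=> /infinite_componentE [v vL]; exists v => // n _; exact: vL.
  by move=> [v _ vL]; apply/infinite_componentE; exists v => n; exact: vL.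
have cvL (r t : R) v : 0 <= r <= 1 -> 0 <= t <= 1 ->
    lift_law G r t (L v n) @[n --> \oo] --> lift_law G r t (\bigcap_n L v n).
  move=> r01 t01; apply: nonincreasing_cvg_mu => //.
  apply: (@le_lt_trans _ _ (lift_law G r t setT)).
    by apply: le_measure; rewrite ?inE.
  rewrite -setXTT [ltLHS]product_measure1E //.
  rewrite [X in (X * _)%E]probability_setT [X in (_ * X)%E]probability_setT.
  rewrite mule1.
  exact: ltry.
have cV : countable [set: G * bool].
  rewrite -setXTT; apply: countableX; first exact: countable_vertex.
  exact: countableP.
have mU : measurable (\bigcup_v \bigcap_n L v n).
  exact: countable_bigcupT_measurable.
rewrite !PsiE => H'.
have H v : lift_law G p q (\bigcap_n L v n) = 0%E.
  apply/eqP; rewrite eq_le measure_ge0 andbT.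
  have <- : lift_law G p' q' (\bigcap_n L v n) = 0%E.
    apply/eqP; rewrite eq_le measure_ge0 andbT -H'.
    by apply: le_measure; rewrite ?inE //; by move=> z vL; exists v.
  apply: (lee_cvg_to (cvL p q v p01 q01) (cvL p' q' v p'01 q'01)).
  by apply: nearW => n; exact: leL.
apply: measure_negligible => //.
have /countable_injP[f fI] := cV.
apply: (@negligibleS _ _ _ _
    (\bigcup_k \bigcup_(v in [set v | f v = k]) \bigcap_n L v n)).
  by move=> z [v _ vL]; exists (f v) => //; exists v.
apply: negligible_bigcup => k.
have [[v fv]|nk] := pselect (exists v, f v = k).
  apply: (@negligibleS _ _ _ _ (\bigcap_n L v n)); last first.
    by apply/negligibleP; [exact: mC|exact: H].
  move=> z [u fu]; rewrite (_ : u = v) //.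
  by apply: fI; rewrite ?in_setT // fu fv.
apply: (@negligibleS _ _ _ _ set0); last exact: negligible_set0.
by move=> z [u fu _]; apply: nk; exists u.
Qed.

(** At t = q the inequalities of [params_le] are strict, since p * (2 - p) is
strictly increasing on [0, 1]; so they persist for t near q. *)
Lemma params_le_nearby (R : realType) (p p' q : R) :
  0 <= p -> p < p' -> p' <= 1 -> 0 < q < 1 ->
  \forall t \near q, params_le p q p' t /\ params_le p t p' q.
Proof.
move=> p0 pp' p'1 /andP[q0 q1].
set a := p * (2 - p); set b := p' * (2 - p').
have ab : a < b by rewrite /a /b; nra.
have cvM (u : R -> R) c : {for q, continuous u} -> u t * c @[t --> q] --> u q * c.
  by move=> cu; apply: cvgMl.
have cid : {for q, continuous (fun t : R => t)} by exact: cvg_id.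
have c1 : {for q, continuous (fun t : R => 1 - t)}.
  by apply: cvgB; [exact: cvg_cst|exact: cvg_id].
have qab : q * a < q * b by rewrite ltr_pM2l.
have q'ab : (1 - q) * a < (1 - q) * b by rewrite ltr_pM2l // subr_gt0.
near=> t; split; split; rewrite ?(ltW pp') //.
- near: t; apply: (cvgr_ge _ (cvM _ b cid)) => //.
- near: t; apply: (cvgr_ge _ (cvM _ b c1)) => //.
- near: t; apply: (cvgr_le _ (cvM _ a cid)) => //.
- near: t; apply: (cvgr_le _ (cvM _ a c1)) => //.
Unshelve. all: by end_near. Qed.

Lemma params_le_mono (R : realType) (p p' q : R) :
  0 <= p -> p <= p' -> p' <= 1 -> 0 <= q <= 1 -> params_le p q p' q.
Proof.
move=> p0 pp' p'1 /andP[q0 q1].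
have ab : p * (2 - p) <= p' * (2 - p') by nra.
by split => //; apply: ler_wpM2l; rewrite ?subr_ge0.
Qed.

Section CriticalValue.
Variables (R : realType) (G : base_graph).
Implicit Types p q : R.

Lemma p_c_ge p q : 0 <= p <= 1 -> Psi G p q = 0%E -> p <= p_c G q.
Proof.
by move=> p01 P0; apply: ub_le_sup; [exists 1 => r [/andP[]]|split].
Qed.

Lemma p_c_ge0 q : 0 <= p_c G q.
Proof.
have [[p [p01 P0]]|nP] :=
    pselect (exists p : R, 0 <= p <= 1 /\ Psi G p q = 0%E).
  by apply: le_trans (p_c_ge p01 P0); case/andP: p01.
rewrite /p_c (_ : [set p | _] = set0) ?sup0 //.
by apply/seteqP; split => // p Hp; apply: nP; exists p.
Qed.

Lemma p_c_le p q : 0 <= p ->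
  (forall r, p < r <= 1 -> Psi G r q <> 0%E) -> p_c G q <= p.
Proof.
move=> p0 H.
have [[r Hr]|nP] := pselect (exists r : R, 0 <= r <= 1 /\ Psi G r q = 0%E).
  apply: ge_sup; first by exists r.
  move=> u [/andP[u0 u1] P0]; rewrite leNgt; apply/negP => pu.
  by apply: (H u); rewrite ?pu.
rewrite /p_c (_ : [set p | _] = set0) ?sup0 //.
by apply/seteqP; split => // u Hu; apply: nP; exists u.
Qed.

Lemma p_c_lt_exists p q : 0 <= p -> p < p_c G q ->
  exists r, p < r <= 1 /\ Psi G r q = 0%E.
Proof.
move=> p0 pc; apply: contrapT => nex.
suff : p_c G q <= p by rewrite leNgt pc.
by apply: p_c_le => // r pr P0; apply: nex; exists r.
Qed.

(** If 0 <= p, some r > p has Psi r q = 0, and for t near q the pair (p, t) is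
dominated by (r, q). *)
Lemma p_c_near_ge p q : 0 < q < 1 -> p < p_c G q ->
  \forall t \near q, p <= p_c G t.
Proof.
move=> /[dup] q01 /andP[q0 q1] pc.
have [p0|p0] := leP 0 p; last first.
  by near=> t; apply: (le_trans (ltW p0)); exact: p_c_ge0.
have [r [/andP[pr r1] P0]] := p_c_lt_exists p0 pc.
have p01 : 0 <= p <= 1 by rewrite p0 (le_trans (ltW pr)).
near=> t; apply: p_c_ge => //.
have t0 : 0 <= t by apply: ltW; near: t; exact: lt_nbhsr.
have t1 : t <= 1 by apply: ltW; near: t; exact: lt_nbhsl.
apply: (Psi_eq0_params_le (p' := r) (q' := q)) => //.
- by rewrite t0.
- by rewrite (le_trans p0 (ltW pr)).
- by rewrite (ltW q0) (ltW q1).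
- have [] // : params_le p q r t /\ params_le p t r q.
  by near: t; exact: params_le_nearby.
Unshelve. all: by end_near. Qed.

(** With p_c q < m < p, the pair (m, q) is dominated by (p, t) for t near q, so
that Psi p t = 0 would give Psi m q = 0.  The neighbourhood of q must not depend
on the zero r > p of Psi _ t that is to be excluded, so r is first lowered
to p. *)
Lemma p_c_near_le p q : 0 < q < 1 -> p_c G q < p ->
  \forall t \near q, p_c G t <= p.
Proof.
move=> /[dup] q01 /andP[q0 q1] pc.
have pc0 := p_c_ge0 q.
have [p1|p1] := leP 1 p.
  near=> t; apply: p_c_le => [|r /andP[pr r1]]; first lra.
  by move: (lt_le_trans pr r1); rewrite ltNge p1.
pose m := (p_c G q + p) / 2.
have cm : p_c G q < m by rewrite /m; lra.
have mp : m < p by rewrite /m; lra.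
have m0 : 0 <= m by lra.
near=> t.
have t0 : 0 <= t by apply: ltW; near: t; exact: lt_nbhsr.
have t1 : t <= 1 by apply: ltW; near: t; exact: lt_nbhsl.
apply: p_c_le; first lra.
move=> r /andP[pr r1] P0.
have Pp : Psi G p t = 0%E.
  apply: (Psi_eq0_params_le (p' := r) (q' := t)) => //; try (apply/andP; lra).
  by apply: params_le_mono; rewrite ?t0 //; lra.
suff : m <= p_c G q by rewrite leNgt cm.
apply: p_c_ge; first by apply/andP; lra.
apply: (Psi_eq0_params_le (p' := p) (q' := t)) => //; try (apply/andP; lra).
have [] // : params_le m q p t /\ params_le m t p q.
by near: t; apply: params_le_nearby => //; exact: ltW.
Unshelve. all: by end_near. Qed.

End CriticalValue.

Theorem theorem1p1 (R : realType) (G : base_graph) :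
  infinite_set [set: G] -> transitive_graph G ->
  {within `]0, 1[, continuous (fun q : R => p_c G q)}.
Proof.
move=> _ _; apply: continuous_in_subspaceT => q /set_mem /=.
rewrite in_itv /= => q01; apply/cvgrPdist_le => e e0.
near=> t; rewrite ler_distlC.
apply/andP; split; near: t.
  by apply: p_c_near_ge => //; rewrite ltrBlDr ltrDl.
by apply: p_c_near_le => //; rewrite ltrDl.
Unshelve. all: by end_near. Qed.
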